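(* Let $\mathcal{X}$ be a Polish space, $\mu_0,\theta\in\mathcal{P}(\mathcal{X})$, let $e_j\in C_b(\mathcal{X})$ and let $\pi_j\colon\mathcal{X}\to\mathbb{R}^{d_j}$ be continuous for $j=1,\dots,J$. Let $\varphi\colon\mathbb{R}\to\mathbb{R}$ be continuous and nondecreasing with $\lim_{x\to-\infty}\varphi(x)=0$ and $\lim_{x\to+\infty}\varphi(x)=1$. Fix $m\in\mathbb{N}$ and let $$\mathcal{H}^m=\Big\{\sum_{j=1}^J e_j\, h_j\circ\pi_j+a : h_j\in\mathfrak{N}_{l_j,d_j,m}(\Xi_{j,m}),\ a\in\mathbb{R}\Big\},$$ where $\mathfrak{N}_{l_j,d_j,m}(\Xi_{j,m})$ is the set of neural networks with activation function $\varphi$ and parameter set $\Xi_{j,m}$ defined in the context. Let $\beta\colon\mathbb{R}\to\mathbb{R}_+$ be a differentiable nondecreasing convex function with $\lim_{x\to\infty}\beta(x)/x=\infty$, $\beta_\gamma(x)=\frac1\gamma\beta(\gamma x)$ for $\gamma>0$, and for $f\in C_b(\mathcal{X})$ let $$\phi^m(f)=\inf\Big\{\int h\,d\mu_0 : h\in\mathcal{H}^m,\ h\ge f\Big\},\qquad \phi^m_{\theta,\gamma}(f)=\inf_{h\in\mathcal{H}^m}\Big\{\int h\,d\mu_0+\int\beta_\gamma(f-h)\,d\theta\Big\}.$$ If all parameter sets $\Xi_{j,m}$, $j=1,\dots,J$, are compact and $\theta$ is strictly positive (i.e. $\theta$ gives positive mass to every non-empty open subset of $\mathcal{X}$), then for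 every $f\in C_b(\mathcal{X})$, $$\phi^m_{\theta,\gamma}(f)\to\phi^m(f)\quad\text{as }\gamma\to\infty.$$
   Context: $\mathcal{P}(\mathcal{X})$ is the set of Borel probability measures on $\mathcal{X}$; $C_b(\mathcal{X})$ is the space of continuous bounded functions $\mathcal{X}\to\mathbb{R}$; inequalities between functions are pointwise. Neural networks: for $l,d,m\in\mathbb{N}$ (with $l\ge1$) a network with $l$ layers, input dimension $d$ and hidden dimension $m$ is a map $\mathbb{R}^d\to\mathbb{R}$ of the form $A_l\circ\varphi\circ A_{l-1}\circ\cdots\circ\varphi\circ A_0$, where $A_0\colon\mathbb{R}^d\to\mathbb{R}^m$, $A_1,\dots,A_{l-1}\colon\mathbb{R}^m\to\mathbb{R}^m$, $A_l\colon\mathbb{R}^m\to\mathbb{R}$ are affine, $A_i(x)=M_ix+b_i$, and $\varphi$ is applied componentwise. The entries of all matrices $M_i$ and vectors $b_i$ together form the parameter $\xi\in\mathbb{R}^{D_m}$ (with $D_m$ depending on $l,d,m$), and the network with parameter $\xi$ is denoted $N_{l,d,m}(\xi)$. For a parameter set $\Xi\subseteq\mathbb{R}^{D_m}$, $\mathfrak{N}_{l,d,m}(\Xi)=\{N_{l,d,m}(\xi):\xi\in\Xi\}$. Standing assumption on parameter sets: for each $j$, with $D_{j,m}$ the number of parameters of networks with $l_j$ layers, input dimension $d_j$ and hidden dimension $m$, one has $[-m,m]^{D_{j,m}}\subseteq\Xi_{j,m}\subseteq\mathbb{R}^{D_{j,m}}$ and $\mathfrak{N}_{l_j,d_j,m}(\Xi_{j,m})\subset\mathfrak{N}_{l_j,d_j,m+1}(\Xi_{j,m+1})$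 for all $m\in\mathbb{N}$. *)

(* Defs.v *)
From mathcomp Require Import all_boot all_order all_algebra.
From mathcomp Require Import all_classical all_reals all_analysis.

Set Implicit Arguments.
Unset Strict Implicit.
Unset Printing Implicit Defensive.

Import Order.TTheory GRing.Theory Num.Theory.
Import numFieldNormedType.Exports.

Local Open Scope classical_set_scope.
Local Open Scope ring_scope.

Definition is_metric (R : realType) (X : Type) (dist : X -> X -> R) : Prop :=
  [/\ forall x y, 0 <= dist x y,
      forall x y, dist x y = 0 <-> x = y,
      forall x y, dist x y = dist y x &
      forall x y z, dist x z <= dist x y + dist y z].

Definition metrizes (R : realType) (X : topologicalType) (dist : X -> X -> R)
    : Prop :=
  forall x : X,
    nbhs x = filter_from [set e : R | 0 < e] (fun e => [set y | dist x y < e]).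

Definition complete_metric (R : realType) (X : topologicalType)
    (dist : X -> X -> R) : Prop :=
  forall u : nat -> X,
    (forall e : R, 0 < e -> exists N : nat, forall p q : nat,
       (N <= p)%N -> (N <= q)%N -> dist (u p) (u q) < e) ->
    exists x : X, u n @[n --> \oo] --> x.

Definition separable (X : topologicalType) : Prop :=
  exists2 A : set X, countable A & dense A.

Definition polish_space (R : realType) (X : topologicalType) : Prop :=
  separable X /\
  exists dist : X -> X -> R,
    [/\ is_metric dist, metrizes dist & complete_metric dist].

(* X as a measurable space, with its Borel sigma-algebra. Measurable types are
   pointed; a space carrying a probability measure is nonempty anyway. *)
Definition borel (X : ptopologicalType) := g_sigma_algebraType (@open X).

Definition strictly_positive (R : realType) (X : ptopologicalType)
    (theta : probability (borel X) R) : Prop :=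
  forall U : set X, open U -> U !=set0 -> (0 < theta U)%E.

Definition continuous_bounded (R : realType) (X : topologicalType)
    : set (X -> R) :=
  [set f | continuous f /\ [bounded f x | x in [set: X]]].

(* An affine map R^p -> R^q, x |-> M x + b, is coded by the vector listing the
   q * p entries of M followed by the q entries of b. *)
Definition affine_dim (p q : nat) : nat := (q * p + q)%N.

Definition affine (R : realType) (p q : nat) (xi : 'rV[R]_(affine_dim p q))
    (x : 'cV[R]_p) : 'cV[R]_q :=
  vec_mx (lsubmx xi) *m x + (rsubmx xi)^T.

(* With k affine maps R^m -> R^m preceding the output map R^m -> R,
   [layers phi xi] is A_{k+1} o phi o A_k o ... o phi o A_1 o phi. *)
Fixpoint layers_dim (m k : nat) : nat :=
  if k is k'.+1 then (affine_dim m m + layers_dim m k')%N else affine_dim m 1.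

Fixpoint layers (R : realType) (phi : R -> R) (m k : nat) :
    'rV[R]_(layers_dim m k) -> 'cV[R]_m -> R :=
  match k with
  | 0%N => fun xi y => affine xi (map_mx phi y) ord0 ord0
  | k'.+1 => fun xi y =>
      layers phi (rsubmx xi) (affine (lsubmx xi) (map_mx phi y))
  end.

(* The number D of parameters. There are l + 1 affine maps A_0, ..., A_l, hence
   l.-1 hidden ones A_1, ..., A_{l-1}; these are only meant for 1 <= l. *)
Definition param_dim (l d m : nat) : nat :=
  (affine_dim d m + layers_dim m l.-1)%N.

Definition network (R : realType) (phi : R -> R) (l d m : nat)
    (xi : 'rV[R]_(param_dim l d m)) (x : 'cV[R]_d) : R :=
  layers phi (rsubmx xi) (affine (lsubmx xi) x).

Definition networks (R : realType) (phi : R -> R) (l d m : nat)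
    (Xi : set 'rV[R]_(param_dim l d m)) : set ('cV[R]_d -> R) :=
  [set network phi xi | xi in Xi].

Definition box (R : realType) (D m : nat) : set 'rV[R]_D :=
  [set xi | forall i : 'I_D, - m%:R <= xi ord0 i <= m%:R].

Definition hedging_set (R : realType) (X : Type) (phi : R -> R) (J : nat)
    (l d : 'I_J -> nat) (m : nat)
    (Xi : forall j : 'I_J, set 'rV[R]_(param_dim (l j) (d j) m))
    (e : 'I_J -> X -> R) (prj : forall j : 'I_J, X -> 'cV[R]_(d j))
    : set (X -> R) :=
  [set h | exists g : forall j : 'I_J, 'cV[R]_(d j) -> R,
           exists a : R,
             (forall j, networks phi (Xi j) (g j)) /\
             h = (fun x => \sum_(j < J) e j x * g j (prj j x) + a)].

Definition scaled_penalty (R : realType) (beta : R -> R) (gamma x : R) : R :=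
  gamma^-1 * beta (gamma * x).

(* Infima are taken in the extended reals, so that inf set0 = +oo. *)
Definition superhedging (R : realType) (X : ptopologicalType)
    (mu0 : probability (borel X) R) (H : set (X -> R)) (f : X -> R) : \bar R :=
  ereal_inf [set (\int[mu0]_x (h x)%:E)%E |
    h in [set h : X -> R | H h /\ forall x, f x <= h x]].

Definition penalized_superhedging (R : realType) (X : ptopologicalType)
    (mu0 theta : probability (borel X) R) (beta : R -> R) (gamma : R)
    (H : set (X -> R)) (f : X -> R) : \bar R :=
  ereal_inf [set (\int[mu0]_x (h x)%:E +
                  \int[theta]_x (scaled_penalty beta gamma (f x - h x))%:E)%E |
    h in H].

(* Main.v *)
(* Write the elements of H as G t + a, with t in the compact product of the
   parameter sets. Since the arguments prj j x are unbounded, t |-> G t is not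
   continuous in the sup norm, so t |-> sup (f - G t) need not be upper
   semicontinuous; one only has joint continuity of G and, by dominated
   convergence, continuity of t |-> int G t dmu0. Both suffice to work locally
   in t: put b = sup (f - G t0) and choose V x U around (t0, x0) on which
   f - G t > b - eps/4. For t in V, either a >= b - eps/2, and then
   int (G t + a) dmu0 is at least the superhedging price up to eps; or
   f - (G t + a) >= (b - a)/2 on U, and superlinearity of beta together with
   theta U > 0 makes the penalty at least b - a for large gamma, which pays for
   raising a to b. Compactness makes "large gamma" uniform in t. The converse
   bound holds because the penalty of a superhedge is at most beta 0 / gamma. *)

Require Import Defs.
From mathcomp Require Import all_boot all_order all_algebra.
From mathcomp Require Import all_classical all_reals all_analysis.
From mathcomp Require Import measurable_realfun ring lra.

Set Implicit Arguments.
Unset Strict Implicit.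
Unset Printing Implicit Defensive.

Import Order.TTheory GRing.Theory Num.Theory.
Import numFieldNormedType.Exports.

Local Open Scope classical_set_scope.
Local Open Scope ring_scope.

(** * Integration of continuous bounded functions *)

Lemma continuous_measurable_borel (R : realType) (X : ptopologicalType)
    (h : X -> R) :
  continuous h -> measurable_fun [set: borel X] (h : borel X -> R).
Proof.
move=> /continuousP ch; apply: (measurability _ (RGenOpens.measurableE R)).
move=> _ [_ [a [b ->] <-]]; rewrite setTI.
by apply: sub_sigma_algebra; apply: ch; exact: interval_open.
Qed.

Section cb_integral.
Variables (R : realType) (X : ptopologicalType) (P : probability (borel X) R).
Implicit Types h : X -> R.

Lemma continuous_bounded_integrable h :
  continuous_bounded h -> P.-integrable [set: borel X] (EFin \o h).
Proof.
move=> [ch bh]; apply: measurable_bounded_integrable => //.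
- by rewrite (le_lt_trans (probability_le1 P measurableT))// ltry.
- exact: continuous_measurable_borel.
Qed.

Lemma continuous_boundedD h k : continuous_bounded h -> continuous_bounded k ->
  continuous_bounded (fun x => h x + k x).
Proof.
move=> [ch bh] [ck bk]; split.
  by move=> x; apply: cvgD; [exact: ch|exact: ck].
exact: bounded_funD.
Qed.

Lemma continuous_bounded_cst (c : R) : continuous_bounded (fun _ : X => c).
Proof. by split; [exact: cst_continuous|exact: bounded_cst]. Qed.

Lemma continuous_bounded_le h M : continuous h -> (forall x, `|h x| <= M) ->
  continuous_bounded h.
Proof.
move=> ch hM; split => //; exists M; split; first exact: num_real.
by move=> N MN x _; exact: le_trans (hM x) (ltW MN).
Qed.

Lemma Rintegral_probability_addc h c : continuous_bounded h ->
  (\int[P]_x (h x + c)%:E)%E = (Rintegral P setT h + c)%:E.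
Proof.
move=> ch; have ih := continuous_bounded_integrable ch.
have ic := continuous_bounded_integrable (continuous_bounded_cst c).
under eq_integral do rewrite EFinD.
rewrite integralD//= integral_cst// [X in (_ * X)%E](probability_setT P).
rewrite mule1 EFinD /Rintegral.
by rewrite fineK//; exact: integrable_fin_num.
Qed.

End cb_integral.

(** * Continuity of integrals in a parameter *)

(** Bridge to dominated convergence, which speaks of sequences: if continuity failed at [t0],
    picking a bad point in each ball of radius 1/(n+1) would give a sequence contradicting the
    hypothesis. *)
Lemma cvg_pseudometric_seq (R : realType) (T : pseudoMetricType R)
    (I : T -> R) (t0 : T) :
  (forall s : nat -> T, s n @[n --> \oo] --> t0 ->
     I (s n) @[n --> \oo] --> I t0) ->
  {for t0, continuous I}.
Proof.
move=> sI; apply/cvgrPdist_le => e e0; apply: contrapT => nI.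
have bad n : exists t, ball t0 (n.+1%:R^-1) t /\ ~ `|I t0 - I t| <= e.
  apply: contrapT => nb; apply: nI.
  near=> t; apply: contrapT => It; apply: nb; exists t; split=> //.
  near: t; exact: (@near_ball _ _ t0 (n.+1%:R^-1)).
have [s hs] := choice bad.
have st : s n @[n --> \oo] --> t0.
  apply/cvg_ballP => d d0; near=> n.
  apply: le_ball (hs n).1; apply/ltW; near: n.
  exact: (near_infty_natSinv_lt (PosNum d0)).
have /cvgrPdist_le/(_ e e0)[N _ /(_ N (leqnn N)) HN] := sI s st.
by case: (hs N).
Unshelve. all: by end_near. Qed.

Lemma continuous_Rintegral_param (R : realType) (X : ptopologicalType)
    (P : probability (borel X) R) (T : pseudoMetricType R)
    (G : T -> X -> R) (t0 : T) :
  (forall t, continuous (G t)) ->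
  (forall x, G t x @[t --> t0] --> G t0 x) ->
  (exists M, \forall t \near t0, forall x, `|G t x| <= M) ->
  {for t0, continuous (fun t => Rintegral P setT (G t))}.
Proof.
move=> cG cGt [M GM]; apply: cvg_pseudometric_seq => s st.
have /= [N _ sM] := st _ GM.
have MT : P.-integrable [set: borel X] (cst M%:E).
  exact: (continuous_bounded_integrable P (continuous_bounded_cst X M)).
(* The bound [M] holds only from index [N] on, so the sequence is shifted to be dominated at every
   index. *)
rewrite -(cvg_shiftn N) /=.
have [||| | |iG _] := @dominated_convergence _ _ _ P setT measurableT
  (fun n x => (G (s (n + N)%N) x)%:E) (fun x => (G t0 x)%:E) (cst M%:E).
- by move=> n; apply/measurable_EFinP; exact: continuous_measurable_borel.
- by apply/measurable_EFinP; exact: continuous_measurable_borel.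
- apply: aeW => x _; apply: cvg_EFin; first by near=> n.
  rewrite (cvg_shiftn N (fun n => G (s n) x)).
  exact: (cvg_comp _ _ st (cGt x)).
- exact: MT.
- by apply: aeW => x n _; rewrite lee_fin; apply: sM; rewrite /= leq_addl.
move=> H; apply: (@fine_cvg R) => /=.
rewrite fineK //; exact: integrable_fin_num.
Unshelve. all: by end_near. Qed.

(** * Joint continuity and uniform bounds of networks *)

Section network_regularity.
Variables (R : realType) (phi : R -> R).

Lemma sum_normr_le n (F : 'I_n -> R) M :
  (forall i, `|F i| <= M) -> `|\sum_(i < n) F i| <= n%:R * M.
Proof.
move=> FM; apply: (le_trans (ler_norm_sum _ _ _)).
apply: (le_trans (ler_sum _ (fun i _ => FM i))).
by rewrite sumr_const card_ord mulr_natl.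
Qed.

(** Convergence is taken entrywise along an arbitrary filter, so that parameter and argument move
    together and the entries of the split parameter vectors are handled directly. *)
Lemma affine_cvg (T : Type) (F : set_system T) p q
    (xi : T -> 'rV[R]_(affine_dim p q)) (xi0 : 'rV[R]_(affine_dim p q))
    (y : T -> 'cV[R]_p) (y0 : 'cV[R]_p) :
  Filter F ->
  (forall i, xi t ord0 i @[t --> F] --> xi0 ord0 i) ->
  (forall i, y t i ord0 @[t --> F] --> y0 i ord0) ->
  forall i, affine (xi t) (y t) i ord0 @[t --> F] --> affine xi0 y0 i ord0.
Proof.
move=> FF cxi cy i.
under eq_fun do rewrite !mxE; rewrite !mxE.
apply: cvgD; last exact: cxi.
apply: cvg_big => [|k _]; first exact: add_continuous.
apply: cvgM; last exact: cy.
under eq_fun do rewrite !mxE; rewrite !mxE.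
exact: cxi.
Qed.

Hypothesis phi_cont : continuous phi.

Lemma layers_cvg (T : Type) (F : set_system T) m k
    (xi : T -> 'rV[R]_(layers_dim m k)) (xi0 : 'rV[R]_(layers_dim m k))
    (y : T -> 'cV[R]_m) (y0 : 'cV[R]_m) :
  Filter F ->
  (forall i, xi t ord0 i @[t --> F] --> xi0 ord0 i) ->
  (forall i, y t i ord0 @[t --> F] --> y0 i ord0) ->
  layers phi (xi t) (y t) @[t --> F] --> layers phi xi0 y0.
Proof.
move=> FF; elim: k xi xi0 y y0 => [|k IH] xi xi0 y y0 cxi cy /=.
  apply: affine_cvg => // i; under eq_fun do rewrite mxE; rewrite mxE.
  by apply: continuous_cvg; [exact: phi_cont|exact: cy].
apply: IH => [i|].
  by under eq_fun do rewrite mxE; rewrite mxE; exact: cxi.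
apply: affine_cvg => i.
  by under eq_fun do rewrite mxE; rewrite mxE; exact: cxi.
under eq_fun do rewrite mxE; rewrite mxE.
by apply: continuous_cvg; [exact: phi_cont|exact: cy].
Qed.

Lemma network_cvg (T : Type) (F : set_system T) l d m
    (xi : T -> 'rV[R]_(param_dim l d m)) xi0 (y : T -> 'cV[R]_d) y0 :
  Filter F -> xi @ F --> xi0 -> y @ F --> y0 ->
  network phi (xi t) (y t) @[t --> F] --> network phi xi0 y0.
Proof.
move=> FF cxi cy.
have cxi' i : xi t ord0 i @[t --> F] --> xi0 ord0 i.
  exact: (cvg_comp _ _ cxi (@coord_continuous _ _ _ ord0 i xi0)).
have cy' i : y t i ord0 @[t --> F] --> y0 i ord0.
  exact: (cvg_comp _ _ cy (@coord_continuous _ _ _ i ord0 y0)).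
apply: layers_cvg => [i|].
  by under eq_fun do rewrite mxE; rewrite mxE; exact: cxi'.
apply: affine_cvg => // i.
by under eq_fun do rewrite mxE; rewrite mxE; exact: cxi'.
Qed.

Hypothesis phi_le1 : forall x, `|phi x| <= 1.

(** Only the output map counts: it receives [m] values of [phi], each at most 1 in absolute value,
    and adds one bias. Hence the bound does not depend on [y]. *)
Lemma layers_le m k (xi : 'rV[R]_(layers_dim m k)) y M :
  (forall i, `|xi ord0 i| <= M) -> `|layers phi xi y| <= m.+1%:R * M.
Proof.
elim: k xi y => [|k IH] xi y xiM /=; last first.
  by apply: IH => i; rewrite mxE.
rewrite !mxE -natr1 mulrDl mul1r (le_trans (ler_normD _ _))// lerD//.
apply: sum_normr_le => i; rewrite !mxE normrM -[M]mulr1.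
by apply: ler_pM.
Qed.

Lemma network_le l d m (xi : 'rV[R]_(param_dim l d m)) y M :
  (forall i, `|xi ord0 i| <= M) -> `|network phi xi y| <= m.+1%:R * M.
Proof. by move=> xiM; apply: layers_le => i; rewrite mxE. Qed.

End network_regularity.

Lemma activation_le1 (R : realType) (phi : R -> R) :
  {homo phi : x y / x <= y} ->
  phi x @[x --> -oo] --> (0 : R) -> phi x @[x --> +oo] --> (1 : R) ->
  forall x, `|phi x| <= 1.
Proof.
move=> phi_nd phi0 phi1 x; rewrite ger0_norm.
  apply: (cvgr_to_ge phi1).
  near=> y; apply: phi_nd; near: y; exact: (nbhs_pinfty_ge (num_real x)).
apply: (cvgr_to_le phi0).
by near=> y; apply: phi_nd; near: y; exact: (nbhs_ninfty_le (num_real x)).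
Unshelve. all: by end_near. Qed.

(** * Estimates of the penalty term *)

Section penalization.
Variables (R : realType) (X : ptopologicalType).
Variables (mu0 theta : probability (borel X) R) (beta : R -> R).
Hypotheses (theta_pos : strictly_positive theta)
  (beta_ge0 : forall x, 0 <= beta x) (beta_nd : {homo beta : x y / x <= y})
  (beta_superlinear : beta x / x @[x --> +oo] --> +oo).

Let penalty gamma (k : X -> R) :=
  (\int[theta]_x (scaled_penalty beta gamma (k x))%:E)%E.

Lemma scaled_penalty_ge0 (gamma x : R) :
  0 < gamma -> 0 <= scaled_penalty beta gamma x.
Proof. by move=> g0; rewrite mulr_ge0// invr_ge0 ltW. Qed.

Lemma scaled_penalty_nd (gamma : R) :
  0 < gamma -> {homo scaled_penalty beta gamma : x y / x <= y}.
Proof.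
move=> g0 x y xy; rewrite ler_pM2l ?invr_gt0//; apply: beta_nd.
by rewrite ler_pM2l.
Qed.

Lemma scaled_penalty_measurable (gamma : R) (k : X -> R) :
  0 < gamma -> continuous k ->
  measurable_fun [set: borel X] (fun x => (scaled_penalty beta gamma (k x))%:E).
Proof.
move=> g0 ck; apply/measurable_EFinP.
apply: (@measurableT_comp _ _ _ _ _ _ (scaled_penalty beta gamma)).
  by apply: nondecreasing_measurable => //; exact: scaled_penalty_nd.
exact: continuous_measurable_borel.
Qed.

Lemma penalty_ge0 (gamma : R) (k : X -> R) :
  0 < gamma -> (0 <= penalty gamma k)%E.
Proof.
by move=> g0; apply: integral_ge0 => x _; rewrite lee_fin scaled_penalty_ge0.
Qed.

Lemma penalty_le (gamma : R) (k : X -> R) :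
  0 < gamma -> continuous k -> (forall x, k x <= 0) ->
  (penalty gamma k <= (beta 0 / gamma)%:E)%E.
Proof.
move=> g0 ck k0.
have -> : ((beta 0 / gamma)%:E = \int[theta]_x (cst (beta 0 / gamma)%:E x))%E.
  by rewrite integral_cst// [X in (_ * X)%E](probability_setT theta) mule1.
apply: ge0_le_integral => //.
- by move=> x _; rewrite lee_fin scaled_penalty_ge0.
- exact: scaled_penalty_measurable.
- move=> x _; rewrite lee_fin (le_trans (scaled_penalty_nd g0 (k0 x)))//.
  by rewrite /scaled_penalty mulr0 mulrC.
Qed.

(** A Markov-type bound: the integrand is nonnegative, so restricting to [U] lowers the integral,
    and on [U] monotonicity applies. *)
Lemma penalty_ge (gamma : R) (k : X -> R) (U : set X) (c : R) :
  0 < gamma -> continuous k -> open U ->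
  (forall x, U x -> c <= k x) ->
  ((scaled_penalty beta gamma c)%:E * theta U <= penalty gamma k)%E.
Proof.
move=> g0 ck oU cU.
have mU : measurable (U : set (borel X)) by exact: sub_sigma_algebra.
have mk := scaled_penalty_measurable g0 ck.
apply: (@le_trans _ _
  (\int[theta]_(x in U) (scaled_penalty beta gamma (k x))%:E)%E).
  rewrite -integral_cst//; apply: ge0_le_integral => //.
  - by move=> x _; rewrite lee_fin scaled_penalty_ge0.
  - exact: measurable_funS mk.
  - by move=> x Ux; rewrite lee_fin scaled_penalty_nd// cU.
apply: ge0_subset_integral => // x _.
by rewrite lee_fin scaled_penalty_ge0.
Qed.

(** The lower bound [s] on [t] is what makes the threshold for [gamma] uniform in [t] and [k]. *)
Lemma penalty_dominates (U : set X) (s : R) : open U -> U !=set0 -> 0 < s ->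
  \forall gamma \near +oo, forall t (k : X -> R), s <= t -> continuous k ->
    (forall x, U x -> t / 2 <= k x) -> (t%:E <= penalty gamma k)%E.
Proof.
move=> oU U0 s0; have tU := theta_pos oU U0.
have mU : measurable (U : set (borel X)) by exact: sub_sigma_algebra.
have tUfin : theta U \is a fin_num by exact: fin_num_measure.
set r := fine (theta U); have r0 : 0 < r by rewrite fine_gt0// tU ltey_eq tUfin.
(* Slope 2/r turns the argument [gamma * (t / 2)] into at least [gamma * t / r]; the factors 1/gamma
   and [theta U] then leave exactly [t]. *)
move/cvgryPge : beta_superlinear => /(_ (2 / r)) [Y [_ hY]].
near=> gamma => t k st ck tk.
have g0 : 0 < gamma by near: gamma; exact: nbhs_pinfty_gt (num_real _).
have t0 : 0 < t by exact: lt_le_trans st.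
have Yt : Y < gamma * (t / 2).
  have : `|Y| * 2 / s < gamma.
    by near: gamma; exact: nbhs_pinfty_gt (num_real _).
  rewrite ltr_pdivrMr// => Ys.
  rewrite (le_lt_trans (ler_norm Y))// mulrA ltr_pdivlMr//.
  by rewrite (lt_le_trans Ys)// ler_pM2l.
have y0 : 0 < gamma * (t / 2) by rewrite mulr_gt0// divr_gt0.
apply: le_trans (penalty_ge g0 ck oU tk).
rewrite -(fineK tUfin) -EFinM lee_fin -/r -ler_pdivrMr// /scaled_penalty.
have := hY _ Yt; rewrite ler_pdivlMr// => hb.
rewrite ler_pdivlMl//; apply: le_trans hb.
by rewrite le_eqVlt; apply/orP; left; apply/eqP; field; exact: lt0r_neq0.
Unshelve. all: by end_near. Qed.


(** * Convergence for a jointly continuous family over a compact parameter set *)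

Variables (T : pseudoMetricType R) (K : set T) (G : T -> X -> R) (f : X -> R).
Hypotheses (K_compact : compact K) (K_neq0 : K !=set0)
  (f_Cb : continuous_bounded f)
  (G_joint : forall t x, G z.1 z.2 @[z --> (t, x)] --> G t x)
  (G_bound : forall t : T, exists M : R, \forall s \near t,
     forall x : X, `|G s x| <= M).

Let H := [set h | exists t a, K t /\ h = (fun x => G t x + a)].
Let S := superhedging mu0 H f.
Let I t := Rintegral mu0 setT (G t).

Let G_cont t : continuous (G t).
Proof.
move=> x; apply: (cvg_comp (fun y => (t, y)) _ _ (G_joint (t:=t) (x:=x))).
by apply: cvg_pair => //; exact: cvg_cst.
Qed.

Let G_Cb t : continuous_bounded (G t).
Proof.
have [M /nbhs_singleton tM] := G_bound t.
exact: continuous_bounded_le (G_cont (t:=t)) tM.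
Qed.

Let I_cont : continuous I.
Proof.
move=> t0; apply: continuous_Rintegral_param => // x.
apply: (cvg_comp (fun s => (s, x)) _ _ (G_joint (t:=t0) (x:=x))).
by apply: cvg_pair => //; exact: cvg_cst.
Qed.

Let G_int t a : (\int[mu0]_x (G t x + a)%:E)%E = (I t + a)%:E.
Proof. exact: Rintegral_probability_addc. Qed.

Let S_le t a : K t -> (forall x, f x <= G t x + a) -> (S <= (I t + a)%:E)%E.
Proof.
move=> Kt fG; rewrite -G_int; apply: ereal_inf_lbound.
by exists (fun x => G t x + a) => //; split => //; exists t, a.
Qed.

Let dominated t : exists a, forall x, f x <= G t x + a.
Proof.
have [M /nbhs_singleton tM] := G_bound t.
have [_ /pinfty_ex_gt0[N _ fN]] := f_Cb.
exists (N + M) => x; have := fN x Logic.I; rewrite /= => fxN.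
have := ler_norm (f x); have := ler_norm (- G t x); rewrite normrN.
have := tM x; lra.
Qed.

(** Every superhedge lies above a lower bound [- N] of [f], and some [G t] with [t] in [K] becomes a
    superhedge after adding a constant. *)
Let S_fin : S \is a fin_num.
Proof.
rewrite fin_numElt; apply/andP; split.
  have [_ /pinfty_ex_gt0[N _ fN]] := f_Cb.
  apply: (@lt_le_trans _ _ (- N)%:E); first exact: ltNyr.
  apply/ereal_infP => _ [h [[t [a [Kt ->]]] fh] <-].
  rewrite G_int lee_fin.
  have <- : Rintegral mu0 setT (fun=> - N) = - N.
    by rewrite Rintegral_cst// [X in fine X](probability_setT mu0) mulr1.
  have -> : I t + a = Rintegral mu0 setT (fun x => G t x + a).
    by rewrite /Rintegral G_int.
  apply: le_Rintegral => //.
  - exact/continuous_bounded_integrable/continuous_bounded_cst.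
  - apply: continuous_bounded_integrable; apply: continuous_boundedD => //.
    exact: continuous_bounded_cst.
  - move=> x _; apply: le_trans (fh x).
    by have := fN x Logic.I; rewrite /= ler_norml => /andP[].
have [t Kt] := K_neq0; have [a fa] := dominated t.
by apply: le_lt_trans (S_le Kt fa) _; exact: ltry.
Qed.

Let k_cont t a : continuous (fun x => f x - (G t x + a)).
Proof.
move=> x; apply: cvgB; first exact: f_Cb.1.
by apply: cvgD; [exact: G_cont|exact: cvg_cst].
Qed.

Let penalized_ge (e : R) : 0 < e -> \forall gamma \near +oo,
  ((fine S - e)%:E <= penalized_superhedging mu0 theta beta gamma H f)%E.
Proof.
move=> e0; move/compact_near_coveringP : K_compact => Kcover.
(* Compactness in covering form reduces the claim to [t] near a fixed [t0]. The constant [a] ranges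
   over a noncompact set, so it is quantified inside the local property. *)
suff : \forall gamma \near +oo, K `<=` (fun t => forall a : R,
    ((fine S - e)%:E <=
     (I t + a)%:E + penalty gamma (fun x => (f x - (G t x + a))%R))%E).
  apply: filterS => gamma gK; apply/ereal_infP => _ [h [t [a [Kt ->]]] <-].
  by rewrite G_int; exact: gK.
apply: (Kcover R +oo (fun gamma t => forall a : R,
    ((fine S - e)%:E <=
     (I t + a)%:E + penalty gamma (fun x => (f x - (G t x + a))%R))%E)).
move=> t0 Kt0.
(* [sup E] is the least constant whose addition to [G t0] gives a superhedge. *)
pose E := range (fun x => f x - G t0 x).
have Esup : has_sup E.
  split; first by exists (f point - G t0 point), point.
  by have [a fa] := dominated t0; exists a => _ [x _ <-]; have := fa x; lra.
have Sle : fine S <= I t0 + sup E.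
  rewrite -lee_fin fineK//; apply: S_le => // x.
  have : f x - G t0 x <= sup E by apply: sup_upper_bound => //; exists x.
  lra.
(* Being within e/8 of the supremum at [x0] leaves room to stay within e/4 nearby. *)
have [_ [x0 _ <-] x0E] := sup_adherent (divr_gt0 e0 (ltr0n R 8)) Esup.
have gap_cvg : f z.2 - G z.1 z.2 @[z --> (t0, x0)] --> f x0 - G t0 x0.
  apply: cvgB; last exact: G_joint.
  by apply: (cvg_comp snd f cvg_snd); exact: f_Cb.1.
have E4 : sup E - e / 4 < f x0 - G t0 x0 by lra.
have [[/= V U] [nV nU] VU] := cvgr_gt _ gap_cvg _ E4.
(* Strict positivity of [theta] concerns open sets, so the neighbourhood is shrunk to an open
   one. *)
have [U' [oU' U'x] U'U] : exists2 U', open_nbhs x0 U' & U' `<=` U.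
  by move: nU; rewrite nbhsE => -[U' ? ?]; exists U'.
have U'0 : U' !=set0 by exists x0.
have e2 : 0 < e / 2 by rewrite divr_gt0.
have I_near : \forall t \near t0, `|I t0 - I t| < e / 2.
  exact: (cvgr_dist_lt _ _ (I_cont (x:=t0)) _ e2).
exists (V `&` [set t | `|I t0 - I t| < e / 2],
        [set gamma | 0 < gamma /\ forall t (k : X -> R), e / 2 <= t ->
           continuous k -> (forall x, U' x -> t / 2 <= k x) ->
           (t%:E <= penalty gamma k)%E]).
  split; first exact: filterI.
  apply: filterI; first exact: nbhs_pinfty_gt.
  exact: penalty_dominates.
move=> [t gamma] /= [[Vt It] [g0 Hg]] a.
have {}It : I t0 - e / 2 < I t by move: It; rewrite ltr_norml; lra.
(* If [a] is at most e/2 below [sup E], the penalty is dropped: one e/2 pays for [a], the other for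
   passing from [I t0] to [I t]. *)
have [ha|ha] := leP (sup E - a) (e / 2).
  apply: le_trans (leeDl _ (penalty_ge0 _ g0)).
  by rewrite lee_fin; lra.
(* Here e/4 is less than half of [sup E - a], so at least half of that gap survives on [U']. *)
have tU x : U' x -> (sup E - a) / 2 <= f x - (G t x + a).
  by move=> /U'U Ux; have := VU (t, x) (conj Vt Ux); rewrite /=; lra.
(* The penalty is at least [sup E - a], so the total is at least [I t + sup E], which exceeds
   [fine S - e / 2]. *)
have := Hg _ _ (ltW ha) (k_cont (t:=t) (a:=a)) tU.
move=> /(leeD2l (I t + a)%:E); apply: le_trans.
by rewrite -EFinD lee_fin; lra.
Qed.

(** A superhedge that is optimal up to e/2 is tested in the penalized problem, where its penalty
    falls below e/2. *)
Let penalized_le (e : R) : 0 < e -> \forall gamma \near +oo,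
  (penalized_superhedging mu0 theta beta gamma H f <= (fine S + e)%:E)%E.
Proof.
move=> e0; have e2 : 0 < e / 2 by rewrite divr_gt0.
have [_ [h [[t [a [Kt ->]]] fG] <-] SG] := lb_ereal_inf_adherent e2 S_fin.
have Ia : I t + a < fine S + e / 2.
  by rewrite -lte_fin (EFinD (fine S)) fineK// -G_int.
near=> gamma.
have g0 : 0 < gamma by near: gamma; exact: nbhs_pinfty_gt (num_real _).
have gb : beta 0 / (e / 2) < gamma.
  by near: gamma; exact: nbhs_pinfty_gt (num_real _).
apply: (@le_trans _ _ ((I t + a)%:E +
    penalty gamma (fun x => (f x - (G t x + a))%R))%E).
  rewrite -G_int; apply: ereal_inf_lbound.
  by exists (fun x => G t x + a) => //; exists t, a.
apply: (@le_trans _ _ ((I t + a)%:E + (beta 0 / gamma)%:E)%E).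
  rewrite leeD2l// penalty_le// => x.
  by rewrite subr_le0.
rewrite -EFinD lee_fin.
suff : beta 0 / gamma < e / 2 by lra.
by rewrite ltr_pdivrMr// mulrC -ltr_pdivrMr.
Unshelve. all: by end_near. Qed.

Lemma penalized_superhedging_cvg :
  penalized_superhedging mu0 theta beta gamma H f @[gamma --> +oo] -->
    superhedging mu0 H f.
Proof.
rewrite -/S -(fineK S_fin); apply/fine_cvgP; split.
  (* The two bounds with tolerance 1 give eventual finiteness. *)
  near=> gamma; rewrite fin_numElt; apply/andP; split.
    apply: lt_le_trans (ltNyr (fine S - 1)) _.
    by near: gamma; exact: penalized_ge.
  apply: le_lt_trans (ltry (fine S + 1)).
  by near: gamma; exact: penalized_le.
apply/cvgrPdist_le => e e0; near=> gamma.
have pl :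
    ((fine S - e)%:E <= penalized_superhedging mu0 theta beta gamma H f)%E.
  by near: gamma; exact: penalized_ge.
have pu :
    (penalized_superhedging mu0 theta beta gamma H f <= (fine S + e)%:E)%E.
  by near: gamma; exact: penalized_le.
move: pl pu; rewrite /comp.
case: (penalized_superhedging _ _ _ _ _ _) => [p| |]//=.
by rewrite !lee_fin ler_distlC => -> ->.
Unshelve. all: by end_near. Qed.

End penalization.

(** * Application to sums of networks *)

Theorem proposition3p7 (R : realType) (X : ptopologicalType)
  (polishX : polish_space R X)
  (mu0 theta : probability (borel X) R)
  (J : nat) (l d : 'I_J -> nat) (l_ge1 : forall j, (1 <= l j)%N)
  (e : 'I_J -> X -> R) (e_Cb : forall j, continuous_bounded (e j))
  (prj : forall j : 'I_J, X -> 'cV[R]_(d j))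
  (prj_cont : forall j, continuous (prj j))
  (phi : R -> R) (phi_cont : continuous phi)
  (phi_nd : {homo phi : x y / x <= y})
  (phi_ninfty : phi x @[x --> -oo] --> (0 : R))
  (phi_pinfty : phi x @[x --> +oo] --> (1 : R))
  (Xi : forall (j : 'I_J) (n : nat), set 'rV[R]_(param_dim (l j) (d j) n))
  (Xi_box : forall j n, @box R (param_dim (l j) (d j) n) n `<=` Xi j n)
  (Xi_incr : forall j n,
    networks phi (Xi j n) `<=` networks phi (Xi j n.+1))
  (beta : R -> R) (beta_ge0 : forall x, 0 <= beta x)
  (beta_diff : forall x, derivable beta x 1)
  (beta_nd : {homo beta : x y / x <= y})
  (beta_cvx : convex_function [set: R^o] beta)
  (beta_superlinear : beta x / x @[x --> +oo] --> +oo)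
  (m : nat)
  (Xi_compact : forall j, compact (Xi j m))
  (theta_pos : strictly_positive theta)
  (f : X -> R) (f_Cb : continuous_bounded f) :
  let H := hedging_set phi (fun j => Xi j m) e prj in
  penalized_superhedging mu0 theta beta gamma H f @[gamma --> +oo] -->
    superhedging mu0 H f.
Proof.
move=> H.
(* All parameters are gathered in one product space, where the constraint set is compact by
   Tychonoff. *)
pose T := prod_topology (fun j => 'rV[R]_(param_dim (l j) (d j) m)).
pose G (t : T) x := \sum_(j < J) e j x * network phi (t j) (prj j x).
have HE : H = [set h | exists t a, (forall j, Xi j m (t j)) /\
                 h = (fun x => G t x + a)].
  apply/seteqP; split=> h.
    move=> [g [a [gXi ->]]].
    (* A parameter realizing each network is picked by choice. *)
    exists (fun j => s2val (cid2 (gXi j))), a.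
    split=> [j|]; first by case: cid2.
    apply/funext => x; congr (_ + a); apply: eq_bigr => j _.
    by case: cid2 => /= xi _ ->.
  move=> [t [a [tXi ->]]]; exists (fun j => network phi (t j)), a.
  by split=> // j; exists (t j).
have phi1 := activation_le1 phi_nd phi_ninfty phi_pinfty.
have t_coord (t : T) j : (s : T) j @[s --> t] --> t j.
  exact: (@proj_continuous _ (fun j => 'rV[R]_(param_dim (l j) (d j) m)) j t).
rewrite HE; apply: (@penalized_superhedging_cvg _ _ _ _ _ theta_pos beta_ge0
  beta_nd beta_superlinear T [set t | forall j, Xi j m (t j)]) => //.
- exact: (@tychonoff _ (fun j => 'rV[R]_(param_dim (l j) (d j) m))
    (fun j => Xi j m)).
(* The zero parameter lies in every box. *)
- by exists (fun=> 0) => j; apply: Xi_box => i; rewrite mxE; apply/andP; split;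
    rewrite ?oppr_le0 ler0n.
- move=> t x; apply: cvg_big => [|j _]; first exact: add_continuous.
  apply: cvgM.
    by apply: (cvg_comp snd _ cvg_snd); exact: (e_Cb j).1.
  apply: network_cvg => //.
    exact: (cvg_comp fst (fun s : T => s j) cvg_fst (t_coord t j)).
  exact: (cvg_comp snd (prj j) cvg_snd (@prj_cont j x)).
move=> t.
have ej (j : 'I_J) : exists N : R, forall x, `|e j x| <= N.
  have [_ /pinfty_ex_gt0[N _ eN]] := e_Cb j.
  by exists N => x; exact: eN.
have [N eN] := choice ej.
(* For [s] within distance 1 of [t] in each coordinate, the entries of [s j] are bounded by the norm
   of [t j] plus 1. *)
exists (\sum_(j < J) N j * (m.+1%:R * (`|t j| + 1))); near=> s => x.
apply: (le_trans (ler_norm_sum _ _ _)); apply: ler_sum => j _.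
rewrite normrM; apply: ler_pM => //; apply: network_le => // i.
apply: (@le_trans _ _ `|s j|).
  by rewrite [leRHS]/Num.norm/= mx_normrE; apply: le_bigmax (ord0, i).
rewrite -[s j](subKr (t j)) (le_trans (ler_normB _ _))// lerD2l ltW//.
move: j {i}; near: s; apply: filter_forall => j.
exact: (cvgr_dist_lt _ _ (t_coord t j) _ ltr01).
Unshelve. all: by end_near. Qed.
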